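(* Let $n>c_1\ge c_2$ be positive integers and let $\Sigma$ be an even positive integer with $nc_1\ge\Sigma\ge nc_2$. If the simple degree sequence region $\mathbb D(n,\Sigma,c_1,c_2)$ is fully graphic, then $\partial^{++}(D)\le 3\cdot n^{13}$ for each $D\in\mathbb D(n,\Sigma,c_1,c_2)$.
   Context: A degree sequence of length $n$ is a sequence $D=(d_1,\dots,d_n)$ of positive integers, each at most $n-1$, with even sum. It is graphic if there is a simple graph on vertex set $\{1,\dots,n\}$ in which vertex $i$ has degree $d_i$ for every $i$; such a graph is called a realization of $D$. $\mathcal G(D)$ denotes the set of all (labelled) realizations of $D$; it is empty if $D$ (an arbitrary integer vector) has no realization. For positive integers $n>c_1\ge c_2$ and even $\Sigma$, $\mathbb D(n,\Sigma,c_1,c_2)$ is the set of all degree sequences $(d_1,\dots,d_n)$ of length $n$ with $c_1\ge d_i\ge c_2$ for all $i$ and $\sum_i d_i=\Sigma$. A set of degree sequences is fully graphic if every element of it is graphic. For $1\le i,j\le n$, $1^{+i}_{+j}$ denotes the integer vector $e_i+e_j$ of length $n$, where $e_i$ is the $i$th standard unit vector. For a graphic degree sequence $D$ of length $n$, $$\partial^{++}(D)=\sum_{1\le i<j\le n}\frac{|\mathcal G(D+1^{+i}_{+j})|}{|\mathcal G(D)|}.$$ *)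

(* Defs.v *)
From mathcomp Require Export all_boot all_order all_algebra.

Set Implicit Arguments.
Unset Strict Implicit.
Unset Printing Implicit Defensive.

Import Order.TTheory GRing.Theory Num.Theory.

(* Vertices are numbered 0, ..., n-1.  Only nonnegative vectors occur: the
   degree sequences D and the vectors D + e_i + e_j. *)
Definition degvec (n : nat) := {ffun 'I_n -> nat}.

Definition is_degree_sequence (n : nat) (D : degvec n) : bool :=
  [forall i, 0 < D i <= n.-1] && ~~ odd (\sum_i D i).

(* A labelled simple graph is given by its edge set, a set of 2-element sets
   of vertices. *)
Definition simple_graph (n : nat) (E : {set {set 'I_n}}) : bool :=
  [forall e in E, #|e| == 2].

Definition degree (n : nat) (E : {set {set 'I_n}}) (v : 'I_n) : nat :=
  #|[set e in E | v \in e]|.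

Definition realizations (n : nat) (D : degvec n) : {set {set {set 'I_n}}} :=
  [set E | simple_graph E & [forall v, degree E v == D v]].

Definition graphic (n : nat) (D : degvec n) : Prop :=
  exists E, E \in realizations D.

Definition region (n Sigma c1 c2 : nat) : pred (degvec n) :=
  [pred D | [&& is_degree_sequence D,
                [forall i, c2 <= D i <= c1]
              & \sum_i D i == Sigma]].
Arguments region : clear implicits.

Definition fully_graphic (n : nat) (A : pred (degvec n)) : Prop :=
  forall D, D \in A -> graphic D.

Definition incr2 (n : nat) (D : degvec n) (i j : 'I_n) : degvec n :=
  [ffun k => D k + (k == i) + (k == j)].

(* Meaningful for graphic D only: otherwise the denominator is 0. *)
Definition partial_pp (n : nat) (D : degvec n) : rat :=
  (\sum_(i < n) \sum_(j < n | (i < j)%N)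
     #|realizations (incr2 D i j)|%:R / #|realizations D|%:R)%R.

(* Main.v *)
Require Import Defs.
From mathcomp Require Import all_boot all_order all_algebra zify.

(* Let G realize D + e_i + e_j with D_i <= D_j.  It suffices to reach a
   realization of D from G by toggling the pairs of consecutive vertices of a
   walk with at most 12 vertices: G is recovered from its image and the walk,
   and i, j from the degrees of G, so the sum is at most n^12.

   Alternating trails (edges and non-edges in turn) do this when they lead from
   i to j.  A closed one at i is also enough: it lowers the degree of i by two,
   and then one edge can be moved from j to i, since j has the larger degree.
   Let c be a neighbour of i or j of largest D, and delete the edge joining it
   to i or j; dually, a closed trail at c starting and ending with a non-edge
   is enough.

   If no such trail is short, then exploring from i yields a clique S adjacent
   to everything outside S and a set T, while exploring from c in the
   complement yields an independent set T' whose neighbours all lie in a set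
   S'; moreover T and S' are disjoint.  Lowering D to c2 on T and raising it
   outside T would violate the Erdos-Gallai inequality of (S, T), so there
   cannot be enough room outside T: c1 (n - |T|) + c2 |T| < Sigma.  Dually,
   Sigma < c1 |S'| + c2 (n - |S'|).  As |T| + |S'| <= n, this is absurd. *)

Set Implicit Arguments.
Unset Strict Implicit.
Unset Printing Implicit Defensive.

Import Order.TTheory GRing.Theory Num.Theory.

(** * Alternating trails and layers *)

Lemma eq_set2P (T : finType) (a b c d : T) :
  reflect (a = c /\ b = d \/ a = d /\ b = c) ([set a; b] == [set c; d]).
Proof.
apply: (iffP eqP) => [eq_ab|[[-> ->] //|[-> ->]]]; last exact: setUC.
have := set21 a b; have := set22 a b; rewrite eq_ab !inE.
have := set21 c d; have := set22 c d; rewrite -eq_ab !inE.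
by do 4!case/orP => /eqP ?; subst; auto.
Qed.

Fixpoint alternating (T : finType) (e : rel T) b x l :=
  if l is y :: l' then
    [&& x != y, e x y == b & alternating e (~~ b) y l']
  else true.

Fixpoint pairs (T : finType) (x : T) l :=
  if l is y :: l' then [set x; y] :: pairs y l' else [::].

Definition trail (T : finType) (e : rel T) b x l :=
  alternating e b x l && uniq (pairs x l).

(** Along an alternating walk, one parity class of the pairs consists of edges and the other of
    non-edges. *)
Fixpoint every_other (S : Type) b (s : seq S) :=
  if s is y :: s' then
    if b then y :: every_other false s' else every_other true s'
  else [::].

Lemma mem_every_other (S : eqType) b (s : seq S) y :
  (y \in s) = (y \in every_other b s) || (y \in every_other (~~ b) s).
Proof.
elim: s b => //= z s IH b; rewrite inE (IH (~~ b)).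
by case: b; rewrite /= !inE //; case: (y == z); rewrite ?orbT.
Qed.

Lemma every_other_pairs (T : finType) (e : rel T) b c x l p :
  alternating e b x l -> p \in every_other c (pairs x l) ->
  exists u v, p = [set u; v] /\ e u v = (b == c).
Proof.
elim: l b c x => [|y l IH] b [] //= x /and3P[_ /eqP exy alt].
  rewrite inE => /orP[/eqP->|/(IH _ _ _ alt)[u [v [-> euv]]]].
    by exists x, y; rewrite exy eqb_id.
  by exists u, v; rewrite euv eqbF_neg negbK eqb_id.
move=> /(IH _ _ _ alt)[u [v [-> euv]]]; exists u, v.
by rewrite euv eqb_id eqbF_neg.
Qed.

(** An edge never equals a non-edge, so distinctness need only be checked inside each parity class;
    this shortens the checks for concrete walks. *)
Lemma alternating_trail (T : finType) (e : rel T) b x l :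
  symmetric e -> alternating e b x l ->
  uniq (every_other true (pairs x l)) -> uniq (every_other false (pairs x l)) ->
  trail e b x l.
Proof.
move=> e_sym; rewrite /trail => alt ut uf; rewrite alt /=.
elim: l b x alt ut uf => //= y l IH b x /and3P[_ /eqP exy alt].
case/andP => xy_notin uf ut; rewrite (IH _ _ alt) // andbT.
rewrite (mem_every_other false) (negbTE xy_notin) /=.
apply/negP => xy_in.
have [u [v [/eqP/eq_set2P eq_xy]]] := every_other_pairs alt xy_in.
have -> : e u v = e x y by case: eq_xy => [[-> ->]|[-> ->]].
by rewrite exy; case: b {exy alt IH}.
Qed.

(* Two vertices differ when some third vertex is adjacent to exactly one of
   them. *)
Ltac clash :=
  match goal with
  | H : ?a = ?b, N : ?a <> ?b |- _ => case: (N H)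
  | H : ?a = ?b, N : ?b <> ?a |- _ => case: (N (esym H))
  | H : ?a = ?b, F : ?g ?a ?w = true, G : ?g ?b ?w = false |- _ =>
      by rewrite H G in F
  | H : ?a = ?b, F : ?g ?a ?w = false, G : ?g ?b ?w = true |- _ =>
      by rewrite H G in F
  | H : ?a = ?b, F : ?g ?w ?a = true, G : ?g ?w ?b = false |- _ =>
      by rewrite H G in F
  | H : ?a = ?b, F : ?g ?w ?a = false, G : ?g ?w ?b = true |- _ =>
      by rewrite H G in F
  end.

(** Expects the status of every pair in both orientations in the context; [edge_facts] and
    [non_edge_facts] are shaped to supply it. *)
Ltac prove_trail :=
  match goal with H : symmetric _ |- _ => apply: (alternating_trail H) end;
  rewrite /= ?inE ?negb_or ?andbT;
  repeat (apply/andP; split);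
  first [ exact: isT
        | by apply/eqP; first [ assumption | apply: nesym; assumption
                              | move=> ?; clash ]
        | by apply/eq_set2P; case=> [[? ?]|[? ?]]; clash ].

Lemma alternating_cat (T : finType) (e : rel T) b x l1 l2 :
  alternating e b x (l1 ++ l2) =
  alternating e b x l1 && alternating e (odd (size l1) (+) b) (last x l1) l2.
Proof.
elim: l1 b x => //= y l1 IH b x; rewrite IH -!andbA; do 3!congr (_ && _).
by rewrite addNb addbN.
Qed.

Lemma pairs_cat (T : finType) (x : T) l1 l2 :
  pairs x (l1 ++ l2) = pairs x l1 ++ pairs (last x l1) l2.
Proof. by elim: l1 x => //= y l1 IH x; rewrite IH. Qed.

Lemma trail_prefix (T : finType) (e : rel T) b x l1 l2 :
  trail e b x (l1 ++ l2) -> trail e b x l1.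
Proof.
rewrite /trail alternating_cat pairs_cat cat_uniq.
by case/andP => /andP[-> _] /and3P[-> _ _].
Qed.

Lemma trail_suffix (T : finType) (e : rel T) b x l1 l2 :
  trail e b x (l1 ++ l2) -> trail e (odd (size l1) (+) b) (last x l1) l2.
Proof.
rewrite /trail alternating_cat pairs_cat cat_uniq.
by case/andP => /andP[_ ->] /and3P[_ _ ->].
Qed.

(** * Exploring from a root that lies on no short closed trail *)

Section Layers.

Variables (T : finType) (e : rel T) (r : T).
Hypotheses (e_sym : symmetric e) (e_irr : irreflexive e).

(* Two non-neighbours leave a choice when a trail leaves a thick vertex, which
   keeps closed walks at the root from using a pair twice.  The other vertices
   may be left unexplored: they miss at most one neighbour of the root, so they
   have enough neighbours in [upper] anyway. *)
Definition thick : {set T} :=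
  [set u | [&& u != r, ~~ e r u & 1 < #|[set v | e r v && ~~ e u v]|]].

(** Ends of alternating trails of one or three pairs from the root that start and end with an edge;
    [lower] allows one more non-edge. They are S and T of the overview, and T' and S' when taken in
    the complement. *)
Definition upper : {set T} :=
  [set v | e r v || [exists u in thick, e u v]].

Definition lower : {set T} :=
  [set x | (x == r) || (x \notin upper) && [exists s in upper, ~~ e x s]].

Lemma edge_facts x y : e x y -> [/\ x <> y, e x y = true & e y x = true].
Proof.
by move=> exy; split=> //; [move=> xy; rewrite xy e_irr in exy | rewrite e_sym].
Qed.

Lemma non_edge_facts x y :
  x <> y -> ~~ e x y -> [/\ x <> y, e x y = false & e y x = false].
Proof. by move=> nxy /negbTE exy; split=> //; rewrite e_sym. Qed.

(** Of the two missed neighbours of the root, one differs from the prescribed [z]; this freedom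
    keeps the pairs of a walk distinct. *)
Lemma thickP u z : u \in thick ->
  [/\ u <> r, e r u = false, e u r = false &
      exists v, [/\ e r v, ~~ e u v & v <> z]].
Proof.
rewrite inE => /and3P[/eqP neq_ur /negbTE Nru /card_gt1P[v [v' []]]].
rewrite !inE => /andP[rv uv] /andP[rv' uv'] neq_vv'.
split=> //; first by rewrite e_sym.
have [vz|vz] := eqVneq v z; last by exists v; split=> //; apply/eqP.
by exists v'; split=> //; apply/eqP; rewrite -vz eq_sym.
Qed.

Lemma upperP s : s \in upper ->
  e r s \/ [/\ e r s = false, s <> r & exists2 u, u \in thick & e u s].
Proof.
rewrite inE; case ers: (e r s) => /=; first by left.
case/existsP => u /andP[uE us]; right; split=> //; last by exists u.
by have [_ _ Nur _] := thickP r uE => sr; rewrite -sr us in Nur.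
Qed.

Lemma root_notin_upper : r \notin upper.
Proof.
apply/negP => /upperP[|[_ /(_ (erefl r)) //]].
by rewrite e_irr.
Qed.

Lemma root_in_lower : r \in lower.
Proof. by rewrite inE eqxx. Qed.

Lemma upper_lower_disjoint : [disjoint upper & lower].
Proof.
rewrite disjoint_sym disjoints_subset; apply/subsetP => x; rewrite !in_setC inE.
by case/orP => [/eqP->|/andP[]//]; exact: root_notin_upper.
Qed.

Lemma non_neighbor_lower s x :
  s \in upper -> x \notin upper -> ~~ e s x -> x \in lower.
Proof.
move=> sS xS sx; rewrite inE xS /=; apply/orP; right; apply/existsP; exists s.
by rewrite sS e_sym.
Qed.

Hypothesis no_closed_trail : forall l,
  size l <= 7 -> odd (size l) -> last r l = r -> ~~ trail e true r l.

Lemma root_nbrs_clique v v' : e r v -> e r v' -> v <> v' -> e v v'.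
Proof.
move=> /edge_facts[? ? ?] /edge_facts[? ? ?] neq; apply: contraT => Nvv'.
have [? ? ?] := non_edge_facts neq Nvv'.
have/negP[] := @no_closed_trail [:: v; v'; r] isT isT erefl.
prove_trail.
Qed.

(** An edge from [u] to a thick [u'] would close the walk r, v, u, u', v', r, with v' chosen
    different from v. *)
Lemma thick_notin_upper u : u \in thick -> u \notin upper.
Proof.
move=> uE; have [nur ru ur _] := thickP r uE.
apply/negP => /upperP[|[_ _ [u' u'E u'u]]]; first by rewrite ru.
have [v [rv Nuv _]] : exists v, [/\ e r v, ~~ e u v & v <> r].
  by have [_ _ _] := thickP r uE.
have [nu'r ru' u'r [v' [rv' Nu'v' nv'v]]] := thickP v u'E.
have nuv : u <> v by move=> uv; rewrite -uv ru in rv.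
have nu'v' : u' <> v' by move=> uv; rewrite -uv ru' in rv'.
have [? ? ?] := non_edge_facts nuv Nuv.
have [? ? ?] := non_edge_facts nu'v' Nu'v'.
have [? ? ?] := edge_facts rv; have [? ? ?] := edge_facts rv'.
have [? ? ?] := edge_facts u'u.
have/negP[] := @no_closed_trail [:: v; u; u'; v'; r] isT isT erefl.
prove_trail.
Qed.

(** A missing edge would join two trails from the root into a closed one. The longest case, with a
    thick vertex on either side, has 7 pairs, whence the bound in [no_closed_trail]. *)
Lemma upper_clique s s' : s \in upper -> s' \in upper -> s <> s' -> e s s'.
Proof.
have mixed v o u : e r v -> e r o = false -> o <> r -> u \in thick -> e u o ->
    v <> o -> e v o.
  move=> rv ro nor uE uo nvo; apply: contraT => Nvo.
  have [nur ru ur [v' [rv' Nuv' nv'v]]] := thickP v uE.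
  have nuv' : u <> v' by move=> uv; rewrite -uv ru in rv'.
  have nuv : u <> v by move=> uv; rewrite -uv ru in rv.
  have [? ? ?] := non_edge_facts nuv' Nuv'.
  have [? ? ?] := non_edge_facts nvo Nvo.
  have [? ? ?] := edge_facts rv; have [? ? ?] := edge_facts rv'.
  have [? ? ?] := edge_facts uo.
  have/negP[] := @no_closed_trail [:: v'; u; o; v; r] isT isT erefl.
  prove_trail.
move=> /upperP[rs|[rs nsr [u uE us]]] /upperP[rs'|[rs' ns'r [u' u'E us']]] nss'.
- exact: root_nbrs_clique.
- exact: mixed us' nss'.
- by rewrite e_sym; apply: mixed us _ => // ss'; apply: nss'.
apply: contraT => Nss'; have [? ? ?] := non_edge_facts nss' Nss'.
have [nur ru ur [v [rv Nuv _]]] := thickP r uE.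
have [nu'r ru' u'r [v' [rv' Nu'v' nv'v]]] := thickP v u'E.
have nuv : u <> v by move=> uv; rewrite -uv ru in rv.
have nu'v' : u' <> v' by move=> uv; rewrite -uv ru' in rv'.
have nuv' : u <> v' by move=> uv; rewrite -uv ru in rv'.
have nu'v : u' <> v by move=> uv; rewrite -uv ru' in rv.
have [? ? ?] := non_edge_facts nuv Nuv.
have [? ? ?] := non_edge_facts nu'v' Nu'v'.
have [? ? ?] := edge_facts rv; have [? ? ?] := edge_facts rv'.
have [? ? ?] := edge_facts us; have [? ? ?] := edge_facts us'.
have/negP[] := @no_closed_trail [:: v; u; s; s'; u'; v'; r] isT isT erefl.
prove_trail.
Qed.

(** The root and the thick vertices have all their neighbours in [upper]. Any other vertex of
    [lower] misses at most one of the more than [q] neighbours of the root. *)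
Lemma lower_nbrs q x : q < #|e r| -> (forall u, u \in thick -> q <= #|e u|) ->
  x \in lower -> q + (x == r) <= #|[set s in upper | e x s]|.
Proof.
move=> r_deg thick_deg xT.
have nbrs_sub y : y = r \/ y \in thick -> #|e y| <= #|[set s in upper | e y s]|.
  move=> y_rE; apply: subset_leq_card; apply/subsetP => s; rewrite !inE => ys.
  rewrite -topredE /= in ys; rewrite ys andbT.
  case: y_rE => [<-|yE]; first by rewrite ys.
  by apply/orP; right; apply/existsP; exists y; rewrite yE.
have [->|nxr] := eqVneq x r.
  by rewrite addn1; apply: leq_trans r_deg _; apply: nbrs_sub; left.
rewrite addn0; case xE: (x \in thick).
  by apply: leq_trans (thick_deg _ xE) _; apply: nbrs_sub; right.
move: xT; rewrite inE (negbTE nxr) /= => /andP[xS _].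
have Nrx : ~~ e r x by apply: contra xS => rx; rewrite inE rx.
have := xE; rewrite inE nxr Nrx /= ltnNge => /negbFE card_le1.
have : #|e r| <= #|[set v | e r v && ~~ e x v]| + #|[set s in upper | e x s]|.
  apply: leq_trans (leq_card_setU _ _).
  apply: subset_leq_card; apply/subsetP => v rv; rewrite -topredE /= in rv.
  by rewrite !inE rv /=; case: (e x v).
move: r_deg card_le1; move: #|e r| #|[set _ | _]| #|[set s in upper | _]|.
by move=> a b c; lia.
Qed.

Lemma card_rest v (A : {set T}) : v \notin A ->
  #|[set u | (u != v) && (u \notin A)]| + #|A| = #|T|.-1.
Proof.
move=> vA; rewrite -(cardC1 v) -(cardID A (predC1 v)) addnC; congr (_ + _).
  apply: eq_card => y; rewrite !inE; case: eqVneq => [->|//].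
  by rewrite (negbTE vA).
by apply: eq_card => y; rewrite !inE andbC.
Qed.

Lemma card_nbrs_le v (A : {set T}) : v \notin A ->
  #|e v| + #|A| <= #|T|.-1 + #|[set u in A | e v u]|.
Proof.
move=> vA; rewrite -(card_rest vA) addnAC leq_add2r addnC.
apply: leq_trans (leq_card_setU _ _); apply: subset_leq_card.
apply/subsetP => y; rewrite -topredE /= => vy; rewrite !inE vy andbT.
case: (y \in A) => //=; rewrite andbT.
by apply: contraTneq vy => ->; rewrite e_irr.
Qed.

Lemma card_nbrs_ge v (A : {set T}) : v \notin A ->
  (forall y, y != v -> y \notin A -> e v y) ->
  #|T|.-1 + #|[set u in A | e v u]| <= #|e v| + #|A|.
Proof.
move=> vA complete; rewrite -(card_rest vA) addnAC leq_add2r.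
rewrite -cardsUI (_ : _ :&: _ = set0) ?cards0 ?addn0.
  apply: subset_leq_card; apply/subsetP => y; rewrite !inE -topredE /=.
  by case/orP => /andP[] //; apply: complete.
by apply/setP => y; rewrite !inE; case: (y \in A); rewrite ?andbF.
Qed.

Lemma double_count (A B : {set T}) :
  \sum_(v in A) #|[set u in B | e v u]| = \sum_(u in B) #|[set v in A | e u v]|.
Proof.
have card_sum (C D : {set T}) v :
    #|[set u in D | e v u]| = \sum_(u in D) e v u.
  by rewrite -sum1_card big_mkcond [RHS]big_mkcond /=;
     apply: eq_bigr => u _; rewrite inE; case: (u \in D); case: (e v u).
under eq_bigr do rewrite card_sum //.
rewrite exchange_big /=; apply: eq_bigr => u _; rewrite card_sum //.
by apply: eq_bigr => v _; rewrite e_sym.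
Qed.

(** Vertices of [upper] are joined to everything outside [lower], and their edges into [lower] are
    counted from the other end by [lower_nbrs]. The surplus neighbour of the root gives strictness,
    which will contradict an Erdos-Gallai inequality. *)
Lemma sum_upper_degrees q : q < #|e r| ->
    (forall u, u \in thick -> q <= #|e u|) ->
  #|upper| * #|T|.-1 + #|lower| * q
    < \sum_(v in upper) #|e v| + #|upper| * #|lower|.
Proof.
move=> r_deg thick_deg.
apply: (@leq_trans
  (#|upper| * #|T|.-1 + \sum_(v in upper) #|[set u in lower | e v u]|)); last first.
  rewrite -!sum_nat_const -!big_split; apply: leq_sum => v vS /=.
  apply: card_nbrs_ge => [|y nyv yT].
    by rewrite (disjointFr upper_lower_disjoint).
  case yS: (y \in upper); first by apply: upper_clique => //; apply/nesym/eqP.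
  by apply: contraNT yT; apply: non_neighbor_lower => //; rewrite yS.
rewrite ltn_add2l double_count.
rewrite (bigD1 r) ?root_in_lower //=.
have := lower_nbrs r_deg thick_deg root_in_lower; rewrite eqxx addn1.
have -> : #|lower| = (\sum_(u in lower | u != r) 1).+1.
  by rewrite -sum1_card (bigD1 r) ?root_in_lower //=.
move=> ltq; rewrite mulSn -addSn leq_add // big_distrl /=.
apply: leq_sum => u /andP[uT nur]; rewrite mul1n.
by have := lower_nbrs r_deg thick_deg uT; rewrite (negbTE nur) addn0.
Qed.

End Layers.

(** * Toggling pairs of a graph, and counting *)

Lemma eq_alternating (T : finType) (e e' : rel T) b x l :
  (forall u v, [set u; v] \in pairs x l -> e u v = e' u v) ->
  alternating e b x l = alternating e' b x l.
Proof.
elim: l b x => //= y l IH b x eq_e.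
rewrite eq_e ?inE ?eqxx // (IH _ y) // => u v uv.
by apply: eq_e; rewrite inE uv orbT.
Qed.

Section Graphs.

Variable n : nat.
Notation V := 'I_n.
Notation graph := {set {set V}}.
Implicit Types (E : graph) (x y u v w : V) (D : degvec n).

Definition adj E : rel V := fun x y => [set x; y] \in E.

(** Leaving a degenerate pair alone allows a walk to be padded by repeating its last vertex. *)
Definition toggle E x y : graph :=
  if x == y then E else [set p | (p \in E) (+) (p == [set x; y])].

Fixpoint flip E x l := if l is y :: l' then flip (toggle E x y) y l' else E.

Lemma adj_sym E : symmetric (adj E).
Proof. by move=> x y; rewrite /adj setUC. Qed.

Lemma adj_irr E : simple_graph E -> irreflexive (adj E).
Proof.
move=> /forallP simE x; apply/negP => xxE.
by have := simE [set x; x]; rewrite -[_ \in _]/(adj E x x) xxE setUid cards1.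
Qed.

Lemma adj_toggle E x y u v : x != y ->
  adj (toggle E x y) u v = adj E u v (+) ([set u; v] == [set x; y]).
Proof. by rewrite /adj /toggle => /negbTE->; rewrite inE. Qed.

Lemma toggle_sym E x y : toggle E x y = toggle E y x.
Proof. by rewrite /toggle eq_sym setUC. Qed.

Lemma toggle_id E x : toggle E x x = E.
Proof. by rewrite /toggle eqxx. Qed.

Lemma toggleK E x y : toggle (toggle E x y) x y = E.
Proof.
rewrite /toggle; case: eqP => // _.
by apply/setP => p; rewrite !inE -addbA addbb addbF.
Qed.

Lemma toggleC E x y u v :
  toggle (toggle E x y) u v = toggle (toggle E u v) x y.
Proof.
rewrite /toggle; case: eqP => // _; case: eqP => // _.
by apply/setP => p; rewrite !inE addbAC.
Qed.

Lemma flip_toggle E u v x l : flip (toggle E u v) x l = toggle (flip E x l) u v.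
Proof. by elim: l E x => //= y l IH E x; rewrite toggleC IH. Qed.

(** Toggles are commuting involutions, so a walk undoes itself even if it repeats pairs. *)
Lemma flipK x l E : flip (flip E x l) x l = E.
Proof.
elim: l x E => //= y l IH x E.
by rewrite -[toggle (flip _ _ _) x y]flip_toggle toggleK IH.
Qed.

Lemma flip_cat E x l1 l2 :
  flip E x (l1 ++ l2) = flip (flip E x l1) (last x l1) l2.
Proof. by elim: l1 E x => //= y l1 IH E x; rewrite IH. Qed.

Lemma flip_nseq E x k : flip E x (nseq k x) = E.
Proof. by elim: k => //= k IH; rewrite toggle_id. Qed.

Lemma toggle_simple E x y : simple_graph E -> simple_graph (toggle E x y).
Proof.
move=> /forallP simE; rewrite /toggle; case: eqVneq => [_|nxy].
  exact/forallP.
apply/forallP => p; apply/implyP; rewrite inE.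
have [->|_] := eqVneq p [set x; y]; first by rewrite cards2 nxy.
by rewrite addbF; apply/implyP.
Qed.

Lemma flip_simple E x l : simple_graph E -> simple_graph (flip E x l).
Proof. by elim: l E x => //= y l IH E x simE; apply/IH/toggle_simple. Qed.

Lemma adj_flip E x l u v : v \notin x :: l -> adj (flip E x l) u v = adj E u v.
Proof.
elim: l E x => //= y l IH E x vN; rewrite IH; last first.
  by move: vN; rewrite in_cons => /norP[].
have [->|nxy] := eqVneq x y; first by rewrite toggle_id.
rewrite adj_toggle //; case: eq_set2P => [xy|]; last by rewrite addbF.
by move: vN; rewrite !inE; case: xy => [[_ ->]|[_ ->]]; rewrite !eqxx ?orbT.
Qed.

Lemma degreeE E v : simple_graph E -> degree E v = #|adj E v|.
Proof.
move=> simE; rewrite /degree -(card_in_imset (f := fun w => [set v; w])).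
  apply: eq_card => p; rewrite inE; apply/andP/imsetP => [[pE vp]|[w]].
    have := forallP simE p; rewrite pE => /cards2P[x [y [_ p_xy]]].
    move: vp pE; rewrite p_xy !inE => /orP[]/eqP-> pE; first by exists y.
    by exists x; rewrite 1?setUC // -topredE /= /adj setUC.
  by rewrite -topredE /= /adj => vw ->; rewrite vw set21.
move=> w w' vw vw' /eqP/eq_set2P[[_ //]|[<- ->]//].
Qed.

(** The additive form covers insertion and deletion at once, without truncated subtraction. *)
Lemma degree_toggle E x y v : x != y ->
  degree (toggle E x y) v + adj E x y * ((v == x) + (v == y)) =
  degree E v + ~~ adj E x y * ((v == x) + (v == y)).
Proof.
move=> nxy; have -> : ((v == x) + (v == y) = (v \in [set x; y])) %N.
  by rewrite !inE; have [->|//] := eqVneq v x; rewrite (negbTE nxy).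
have degD1 (F : graph) : [set x; y] \in F ->
    degree F v = (v \in [set x; y]) + degree (F :\ [set x; y]) v.
  move=> pF; rewrite /degree (cardsD1 [set x; y]) !inE pF; congr (_ + _).
  by apply: eq_card => p; rewrite !inE andbA.
rewrite /adj; case: (boolP ([set x; y] \in E)) => pE.
  rewrite mul1n mul0n addn0 (degD1 E) // addnC; congr (_ + degree _ _).
  apply/setP => p; rewrite /toggle (negbTE nxy) !inE.
  by have [->|_] := eqVneq p [set x; y]; rewrite ?pE ?addbF.
rewrite mul1n mul0n addn0 (degD1 (toggle E x y)); last first.
  by rewrite /toggle (negbTE nxy) inE eqxx (negbTE pE).
rewrite addnC; congr (degree _ _ + _); apply/setP => p.
rewrite /toggle (negbTE nxy) !inE.
by have [->|_] := eqVneq p [set x; y]; rewrite ?(negbTE pE) ?addbF.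
Qed.

Definition sgb (b : bool) : int := (if b then 1 else -1)%R.

(** At inner visits a gained and a lost edge cancel, so only the two ends count. The last pair is an
    edge iff [b (+) ~~ odd (size l)]; for the empty walk the two terms cancel. *)
Lemma degree_flip E b x l v : trail (adj E) b x l ->
  (Posz (degree (flip E x l) v) =
   Posz (degree E v) - sgb b * Posz (v == x) -
   sgb (b (+) ~~ odd (size l)) * Posz (v == last x l))%R.
Proof.
elim: l E b x => [|y l IH] E b x /=; first by
  rewrite addbT /sgb; move: (degree E v) (v == x) => d c; case: b => /=; lia.
move=> /andP[/and3P[nxy /eqP exy alt] /= /andP[xyN uniq_l]].
(* Since the pairs are distinct, toggling the first one leaves the rest alternating. *)
rewrite (IH _ (~~ b)); last first.
  rewrite /trail uniq_l andbT -(eq_alternating _ (e := adj E)) // => u w uw.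
  rewrite adj_toggle //; case: eqP => [uwxy|_]; last by rewrite addbF.
  by rewrite -uwxy uw in xyN.
have := degree_toggle E v nxy; rewrite exy addNb -addbN /sgb.
move: (degree _ v) (degree E v) (v == x) (v == y) (v == last _ _) => d d' c1 c2 c3.
by case: b {exy alt IH}; case: (odd _) => /=; lia.
Qed.

(** * Counting realizations by short walks *)

Lemma realizationsP D E :
  reflect (simple_graph E /\ forall v, degree E v = D v) (E \in realizations D).
Proof.
rewrite inE; apply: (iffP andP) => -[-> degE]; split=> //.
  by move=> v; apply/eqP; apply/forallP: v.
by apply/forallP => v; rewrite degE.
Qed.

(** With a fixed length there are exactly [n ^ 12] choices of start and walk; [nearI] pads shorter
    walks. *)
Definition near D E :=
  [exists x, exists t : 11.-tuple V, flip E x t \in realizations D].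

Lemma nearI D E x l :
  size l <= 11 -> flip E x l \in realizations D -> near D E.
Proof.
move=> size_l El; pose l' := l ++ nseq (11 - size l) (last x l).
have size_l' : size l' == 11 by rewrite size_cat size_nseq subnKC.
apply/existsP; exists x; apply/existsP; exists (Tuple size_l').
by rewrite /= flip_cat flip_nseq.
Qed.

Lemma incr2_inj D (i j i' j' : V) : i < j -> i' < j' ->
  incr2 D i j = incr2 D i' j' -> (i, j) = (i', j').
Proof.
move=> ij ij' eqD.
have eq_at v : (v == i) + (v == j) = (v == i') + (v == j').
  by have := congr1 (fun F : degvec n => F v) eqD; rewrite !ffunE -!addnA => /addnI.
have := eq_at i; have := eq_at j; have := eq_at i'.
rewrite !eqxx -!val_eqE /= => e1 e2 e3.
have ii' : i = i' by apply: val_inj => /=; lia.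
by congr (_, _) => //; apply: val_inj => /=; move: e1 e2 e3; rewrite ii'; lia.
Qed.

(** An image and a walk determine the original graph by [flipK], hence its degrees, hence [i] and
    [j] by [incr2_inj]; so each code is counted at most once. *)
Lemma sum_realizations D :
  (forall i j : V, i < j -> forall E, E \in realizations (incr2 D i j) ->
    near D E) ->
  \sum_(i < n) \sum_(j < n | i < j) #|realizations (incr2 D i j)|
    <= #|realizations D| * n ^ 12.
Proof.
move=> near_all.
pose code := (V * 11.-tuple V)%type.
have card_code : #|{: code}| = n ^ 12.
  by rewrite card_prod card_tuple card_ord -expnS.
pose hits (c : graph * code) (i j : V) :=
  flip c.1 c.2.1 c.2.2 \in realizations (incr2 D i j).
pose C := setX (realizations D) [set: code].
have card_C : #|C| = #|realizations D| * n ^ 12.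
  by rewrite cardsX cardsT card_code.
have le_hits (i j : V) : i < j ->
    #|realizations (incr2 D i j)| <= \sum_(c in C) hits c i j.
  move=> ij.
  have -> : \sum_(c in C) hits c i j = #|[set c in C | hits c i j]|.
    rewrite -sum1_card big_mkcond [RHS]big_mkcond /=; apply: eq_bigr => c _.
    by rewrite [in RHS]inE; case: (c \in C); case: (hits c i j).
  pose F (c : graph * code) := flip c.1 c.2.1 c.2.2.
  apply: leq_trans (leq_imset_card F _).
  apply: subset_leq_card; apply/subsetP => E ER.
  have /existsP[x /existsP[t Et]] := near_all i j ij E ER.
  apply/imsetP; exists (flip E x t, (x, t)); last by rewrite /F /= flipK.
  by rewrite inE /hits /= flipK ER andbT /C inE /= Et inE.
rewrite -card_C -sum1_card.
apply: (@leq_trans (\sum_(i < n) \sum_(j < n | i < j) \sum_(c in C) hits c i j)).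
  by apply: leq_sum => i _; apply: leq_sum => j ij; apply: le_hits.
rewrite pair_big_dep exchange_big /=; apply: leq_sum => c _.
have [/existsP[p /andP[p_lt p_hit]]|noneP] :=
  boolP [exists p : V * V, (p.1 < p.2) && hits c p.1 p.2].
  rewrite (bigD1 p) //= p_hit big1 // => p' /andP[p'_lt np].
  case p'_hit: (hits c p'.1 p'.2) => //; case/eqP: np.
  rewrite [p']surjective_pairing [p]surjective_pairing.
  apply: (@incr2_inj D) => //; apply/ffunP => v.
  move/realizationsP: p_hit => [_ <-].
  by move/realizationsP: p'_hit => [_ <-].
rewrite big1 // => p p_lt; case p_hit: (hits c p.1 p.2) => //.
by case/existsP: noneP; exists p; rewrite p_lt p_hit.
Qed.

Lemma partial_pp_le D : 0 < n -> graphic D ->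
  (forall i j : V, i < j -> forall E, E \in realizations (incr2 D i j) ->
    near D E) ->
  (partial_pp D <= 3 * n%:R ^+ 13)%R.
Proof.
move=> n_gt0 [E0 E0R] near_all.
have R_gt0 : 0 < #|realizations D| by apply/card_gt0P; exists E0.
have -> : partial_pp D =
  ((\sum_(i < n) \sum_(j < n | (i < j)%N) #|realizations (incr2 D i j)|)%:R
     / #|realizations D|%:R)%R.
  rewrite natr_sum mulr_suml; apply: eq_bigr => i _.
  by rewrite natr_sum mulr_suml; apply: eq_bigr.
rewrite ler_pdivrMr ?ltr0n // -natrX -!natrM ler_nat.
apply: leq_trans (sum_realizations near_all) _.
rewrite mulnC leq_mul2r; apply/orP; right.
by rewrite (@leq_trans (n ^ 13)) ?leq_pexp2l // leq_pmull.
Qed.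

End Graphs.

(** * Inequalities from full graphicality *)

(** Induction on the deficit: while it is positive, some coordinate can still be raised by one. *)
Lemma sum_interpolate (T : finType) (f g : T -> nat) K :
  (forall i, f i <= g i) -> \sum_i f i <= K <= \sum_i g i ->
  exists2 h : T -> nat, (forall i, f i <= h i <= g i) & \sum_i h i = K.
Proof.
move=> le_fg /andP[]; move Em: (K - \sum_i f i) => m.
elim: m f le_fg Em => [|m IH] f le_fg Em leK geK.
  exists f => [i|]; first by rewrite leqnn le_fg.
  by apply/eqP; rewrite eqn_leq leK -subn_eq0 Em.
have [/existsP[i0 lt0]|noneP] := boolP [exists i, f i < g i]; last first.
  have : \sum_i g i <= \sum_i f i.
    by apply: leq_sum => i _; rewrite leqNgt; apply: contra noneP => lt_fg;
       apply/existsP; exists i.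
  by move: Em geK; lia.
pose f' i := f i + (i == i0).
have sum_f' : \sum_i f' i = (\sum_i f i).+1.
  rewrite big_split /= -addn1; congr (_ + _).
  by rewrite (bigD1 i0) //= eqxx big1 ?addn0 // => i /negbTE->.
have [i||||h le_h sum_h] := IH f'.
- by rewrite /f'; case: eqP => [->|_]; rewrite ?addn1 ?addn0.
- by rewrite sum_f'; lia.
- by rewrite sum_f'; lia.
- exact: geK.
exists h => // i; case/andP: (le_h i) => fh ->; rewrite andbT.
exact: leq_trans (leq_addr _ _) fh.
Qed.

Section Cuts.

Variables (n c1 c2 Sigma : nat).
Hypotheses (c2_gt0 : 0 < c2) (c1_ltn : c1 < n) (Sigma_even : ~~ odd Sigma).
Hypothesis region_graphic : fully_graphic (region n Sigma c1 c2).
Variable D : degvec n.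
Hypothesis D_region : D \in region n Sigma c1 c2.
Variables S T : {set 'I_n}.
Hypothesis disjST : [disjoint S & T].

Lemma region_bounds v : c2 <= D v <= c1.
Proof. by case/and3P: D_region => _ /forallP. Qed.

Lemma region_sum : \sum_v D v = Sigma.
Proof. by case/and3P: D_region => _ _ /eqP. Qed.

(** [h] lies in the region, hence has a realization. There a vertex of [S] has at most [n.-1 - #|T|]
    neighbours outside [T], and the edges between [S] and [T] are bounded by the degrees in [T]. *)
Lemma region_cut (h : 'I_n -> nat) :
  (forall v, c2 <= h v <= c1) -> \sum_v h v = Sigma ->
  \sum_(v in S) h v + #|S| * #|T| <= #|S| * n.-1 + \sum_(v in T) h v.
Proof.
move=> bnd_h sum_h; pose H : degvec n := [ffun v => h v].
have HE v : H v = h v by rewrite ffunE.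
have [E /realizationsP[simE degE]] : graphic H.
  apply: region_graphic; rewrite inE /=.
  have sumH : \sum_v H v = Sigma by rewrite -sum_h; apply: eq_bigr => v _.
  rewrite sumH eqxx andbT; apply/andP; split.
    rewrite /is_degree_sequence sumH Sigma_even andbT; apply/forallP => v.
    by rewrite HE; have /andP[] := bnd_h v; move: c1_ltn c2_gt0; lia.
  by apply/forallP => v; rewrite HE.
have hE v : h v = #|adj E v| by rewrite -degreeE // degE HE.
have -> : \sum_(v in S) h v = \sum_(v in S) #|adj E v|.
  by apply: eq_bigr => v _.
apply: (@leq_trans (#|S| * n.-1 + \sum_(v in S) #|[set u in T | adj E v u]|)).
  rewrite -!sum_nat_const -!big_split; apply: leq_sum => v vS /=.
  rewrite -[n in n.-1]card_ord.
  by apply: card_nbrs_le; [exact: adj_irr | rewrite (disjointFr disjST)].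
rewrite leq_add2l (double_count (@adj_sym n E)).
apply: leq_sum => u uT; rewrite hE; apply: subset_leq_card.
by apply/subsetP => v; rewrite inE => /andP[].
Qed.

Lemma sum_if_const (A : {set 'I_n}) (a : nat) (f : 'I_n -> nat) :
  \sum_v (if v \in A then a else f v) = #|A| * a + \sum_(v | v \notin A) f v.
Proof.
rewrite (bigID (mem A)) /= -sum_nat_const; congr (_ + _).
  by apply: eq_bigr => v ->.
by apply: eq_bigr => v /negbTE->.
Qed.

Lemma card_notin (A : {set 'I_n}) : #|[set v | v \notin A]| = n - #|A|.
Proof.
rewrite -[n in n - _]card_ord -(cardsC A) addKn.
by apply: eq_card => v; rewrite !inE.
Qed.

(** The hypothesis leaves room to lower [D] to [c2] on [T] and raise it elsewhere, keeping the sum;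
    [region_cut] for the new sequence is the sharper bound. *)
Lemma low_cut : Sigma <= c1 * (n - #|T|) + c2 * #|T| ->
  \sum_(v in S) D v + #|S| * #|T| <= #|S| * n.-1 + #|T| * c2.
Proof.
move=> le_Sigma.
have [v||h le_h sum_h] := @sum_interpolate _
  (fun v => if v \in T then c2 else D v)
  (fun v => if v \in T then c2 else c1) Sigma.
- case: ifP => // _; by case/andP: (region_bounds v).
- apply/andP; split.
    rewrite -region_sum; apply: leq_sum => v _.
    by case: ifP => // _; case/andP: (region_bounds v).
  by rewrite sum_if_const sum_nat_cond_const card_notin addnC mulnC (mulnC _ c2).
have bnd_h v : c2 <= h v <= c1.
  have /= := le_h v; have := region_bounds v.
  by case: ifP => _; move: (D v) (h v) => d k; lia.
apply: leq_trans (_ : _ <= \sum_(v in S) h v + #|S| * #|T|) _.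
  rewrite leq_add2r; apply: leq_sum => v vS; have /= := le_h v.
  by rewrite (disjointFr disjST vS) => /andP[].
apply: leq_trans (region_cut bnd_h sum_h) _.
rewrite leq_add2l -sum_nat_const; apply: leq_sum => v vT.
by have /= := le_h v; rewrite vT => /andP[].
Qed.

(** Dual to [low_cut]: [D] is raised to [c1] on [S] and lowered elsewhere. *)
Lemma high_cut : c1 * #|S| + c2 * (n - #|S|) <= Sigma ->
  #|S| * c1 + #|S| * #|T| <= #|S| * n.-1 + \sum_(v in T) D v.
Proof.
move=> ge_Sigma.
have [v||h le_h sum_h] := @sum_interpolate _
  (fun v => if v \in S then c1 else c2)
  (fun v => if v \in S then c1 else D v) Sigma.
- case: ifP => // _; by case/andP: (region_bounds v).
- apply/andP; split.
    by rewrite sum_if_const sum_nat_cond_const card_notin mulnC (mulnC _ c2).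
  rewrite -region_sum; apply: leq_sum => v _.
  by case: ifP => // _; case/andP: (region_bounds v).
have bnd_h v : c2 <= h v <= c1.
  have /= := le_h v; have := region_bounds v.
  by case: ifP => _; move: (D v) (h v) => d k; lia.
apply: leq_trans (_ : _ <= \sum_(v in S) h v + #|S| * #|T|) _.
  rewrite leq_add2r -sum_nat_const; apply: leq_sum => v vS; have /= := le_h v.
  by rewrite vS => /andP[].
apply: leq_trans (region_cut bnd_h sum_h) _.
rewrite leq_add2l; apply: leq_sum => v vT; have /= := le_h v.
by rewrite (disjointFl disjST vT) => /andP[].
Qed.

End Cuts.

(** * Trails joining the two layerings *)

Definition compl_rel (T : eqType) (f : rel T) : rel T :=
  fun x y => (x != y) && ~~ f x y.

Lemma compl_rel_sym (T : eqType) (f : rel T) :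
  symmetric f -> symmetric (compl_rel f).
Proof. by move=> f_sym x y; rewrite /compl_rel eq_sym f_sym. Qed.

Lemma compl_rel_irr (T : eqType) (f : rel T) : irreflexive (compl_rel f).
Proof. by move=> x; rewrite /compl_rel eqxx. Qed.

Lemma trail_compl (T : finType) (f : rel T) b x l :
  trail (compl_rel f) b x l = trail f (~~ b) x l.
Proof.
rewrite /trail; congr (_ && _); elim: l b x => //= y l IH b x.
by rewrite IH /compl_rel; case: (x != y) => //=; case: b; case: (f x y).
Qed.

Lemma card_compl_rel (T : finType) (f : rel T) x : irreflexive f ->
  #|compl_rel f x| + #|f x| = #|T|.-1.
Proof.
move=> f_irr; rewrite -(cardC1 x) -(cardID (f x) (predC1 x)) addnC.
congr (_ + _); apply: eq_card => y; rewrite !inE -!topredE /= /compl_rel /=.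
  by case: eqVneq => [->|]; rewrite ?f_irr.
by rewrite eq_sym andbC.
Qed.

Section Crossing.

Variables (T : finType) (e f : rel T) (i r c : T).
Hypotheses (e_sym : symmetric e) (e_irr : irreflexive e).
Hypotheses (f_sym : symmetric f) (f_irr : irreflexive f).
Hypothesis f_sub : forall x y, f x y -> e x y.
Hypothesis f_eq : forall x y, x <> c -> y <> c -> e x y -> f x y.
Hypotheses (neq_ic : i <> c) (Nfci : ~~ f c i).
Hypothesis c_notin_lower : c \notin lower e i.
Hypothesis c_notin_thick : c \notin thick e i.

Let fC := compl_rel f.
Let fC_sym : symmetric fC := compl_rel_sym f_sym.

(* The trail is c, a, (b, d,) x, (s, u,) v, i, with each parenthesised pair
   possibly absent; b is thick for c and u is thick for i, so a and v can be
   chosen to make the pairs distinct. *)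
Lemma crossing_trail x : x \in lower e i -> x \in lower fC c ->
  exists l, [/\ trail f false c l, last c l = i, ~~ odd (size l) & size l <= 8].
Proof.
move=> xL xLC.
(* In the application [f] is [e] without one edge at [c]: non-edges pass from [e] to [f], and so do
   edges avoiding [c]. *)
have Nf x' y : ~~ e x' y -> ~~ f x' y by apply/contra/f_sub.
have i_upper : i \in upper fC c.
  by rewrite inE /fC /compl_rel Nfci; move/eqP: neq_ic; rewrite eq_sym => ->.
have fCE a b : a <> b -> ~~ fC a b -> f a b.
  by move=> /eqP nab; rewrite /fC /compl_rel nab negbK.
have fCN a b : fC a b -> a <> b /\ ~~ f a b by case/andP => /eqP.
have nxc : x <> c by move=> xc; case/negP: c_notin_lower; rewrite -xc.
have : x \notin upper fC c.
  apply: contraL xLC => xU.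
  by rewrite (disjointFr (upper_lower_disjoint c fC_sym (@compl_rel_irr _ f))).
move=> xUC; have nxi : x <> i by move=> xi; rewrite xi i_upper in xUC.
have fcx : f c x.
  apply: fCE; first exact: nesym.
  by apply: contra xUC => cx; rewrite inE cx.
move: xLC; rewrite inE => /orP[/eqP//|/andP[_ /existsP[d /andP[dU NxdC]]]].
have fxd : f x d by apply: fCE => // xd; rewrite xd dU in xUC.
move: (xL); rewrite inE => /orP[/eqP//|/andP[xU /existsP[s /andP[sU Nxs]]]].
have Nix : ~~ f i x by apply: Nf; apply: contra xU => ix; rewrite inE ix.
have nxs : x <> s by move=> xs; rewrite xs sU in xU.
have ncd : c <> d.
  move=> cd; have /negP[] := root_notin_upper c fC_sym (@compl_rel_irr _ f).
  by rewrite [X in X \in _]cd.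
have [? ? ?] := edge_facts f_sym f_irr fcx.
have [? ? ?] := edge_facts f_sym f_irr fxd.
have [? ? ?] := non_edge_facts f_sym nxs (Nf _ _ Nxs).
have [? ? ?] := non_edge_facts f_sym (nesym neq_ic) Nfci.
have [? ? ?] := non_edge_facts f_sym (nesym nxi) Nix.
have nsc : s <> c by move=> ?; clash.
case/(upperP fC_sym): dU => [/fCN[nca Nfca]|[/negbT NcdC _ [b b_thick bdC]]].
  have [? ? ?] := non_edge_facts f_sym nca Nfca.
  case/(upperP e_sym): sU => [eis|[/negbT Nis nsi [u u_thick us]]].
    have [? ? ?] := edge_facts f_sym f_irr (f_eq neq_ic nsc eis).
    exists [:: d; x; s; i]; split=> //; prove_trail.
  have [nui _ Nui [v [iv Nuv nvc]]] := thickP e_sym c u_thick.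
  have nuc : u <> c by move=> uc; case/negP: c_notin_thick; rewrite -uc.
  have nuv : u <> v by move=> uv; rewrite uv e_sym iv in Nui.
  have [? ? ?] := edge_facts f_sym f_irr (f_eq nuc nsc us).
  have [? ? ?] := edge_facts f_sym f_irr (f_eq neq_ic nvc iv).
  have [? ? ?] := non_edge_facts f_sym nuv (Nf _ _ Nuv).
  have [? ? ?] := non_edge_facts f_sym nui (Nf _ _ (negbT Nui)).
  have [? ? ?] := non_edge_facts f_sym nsi (Nf s i ltac:(by rewrite e_sym)).
  exists [:: d; x; s; u; v; i]; split=> //; prove_trail.
have [? ? ?] := edge_facts f_sym f_irr (fCE _ _ ncd NcdC).
have [nbd Nfbd] := fCN _ _ bdC.
have [? ? ?] := non_edge_facts f_sym nbd Nfbd.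
have [nbc NcbC _ _] := thickP fC_sym c b_thick.
have [? ? ?] := edge_facts f_sym f_irr (fCE _ _ (nesym nbc) (negbT NcbC)).
have pick_a z : exists a, [/\ c <> a, ~~ f c a, f b a & a <> z].
  have [_ _ _ [a [caC NbaC naz]]] := thickP fC_sym z b_thick.
  have [nca Nfca] := fCN _ _ caC.
  exists a; split=> //; apply: fCE => // ba.
  by rewrite -ba NcbC in caC.
case/(upperP e_sym): sU => [eis|[/negbT Nis nsi [u u_thick us]]].
  have [a [nca Nfca fba nai]] := pick_a i.
  have [? ? ?] := edge_facts f_sym f_irr (f_eq neq_ic nsc eis).
  have [? ? ?] := edge_facts f_sym f_irr fba.
  have [? ? ?] := non_edge_facts f_sym nca Nfca.
  exists [:: a; b; d; x; s; i]; split=> //; prove_trail.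
have [nui _ Nui _] := thickP e_sym c u_thick.
have nuc : u <> c by move=> uc; case/negP: c_notin_thick; rewrite -uc.
have [? ? ?] := edge_facts f_sym f_irr (f_eq nuc nsc us).
have [? ? ?] := non_edge_facts f_sym nui (Nf _ _ (negbT Nui)).
have [? ? ?] := non_edge_facts f_sym nsi (Nf s i ltac:(by rewrite e_sym)).
(* If [b] is [s] or [u], then [a] avoids the other one, and [a] is not [i] because [i] is adjacent
   to neither. Otherwise the freedom is spent on avoiding [i]. *)
have [a [nca Nfca fba nai a_set]] : exists a,
    [/\ c <> a, ~~ f c a, f b a, a <> i & [set a; b] <> [set s; u]].
  have [a [nca Nfca fba naz]] :=
    pick_a (if b == s then u else if b == u then s else i).
  have [? ? ?] := edge_facts f_sym f_irr fba.
  exists a; move: naz; have [bs|/eqP nbs] := eqVneq b s => naz.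
    by subst b; split=> //; [move=> ?; clash
      | move/eqP/eq_set2P => [[? ?]|[? ?]]; clash].
  move: naz; have [bu|/eqP nbu] := eqVneq b u => naz.
    by subst b; split=> //; [move=> ?; clash
      | move/eqP/eq_set2P => [[? ?]|[? ?]]; clash].
  by split=> //; move/eqP/eq_set2P => [[? ?]|[? ?]]; clash.
(* Likewise for [v]: if [u] is [b] or [d], it is adjacent to [c], so its non-neighbour [v] is not
   [c]. *)
have [v [iv Nuv nvc v_set]] : exists v,
    [/\ e i v, ~~ e u v, v <> c & [set b; d] <> [set u; v]].
  have e_c y : f c y -> e y c by rewrite f_sym => /f_sub.
  have [_ _ _ [v [iv Nuv nvz]]] :=
    thickP e_sym (if u == b then d else if u == d then b else c) u_thick.
  have nuv : u <> v by move=> uv; rewrite uv e_sym iv in Nui.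
  have nvc_of : e u c -> v <> c by move=> uc vc; rewrite vc uc in Nuv.
  exists v; move: nvz; have [ub|/eqP nub] := eqVneq u b => nvz.
    split=> //; first by apply: nvc_of; rewrite ub; apply: e_c.
    by move/eqP/eq_set2P => [[? ?]|[? bv]]; [clash | case: nuv; rewrite ub].
  move: nvz; have [ud|/eqP nud] := eqVneq u d => nvz.
    split=> //; first by apply: nvc_of; rewrite ud; apply: e_c.
    by move/eqP/eq_set2P => [[? ?]|[? ?]]; clash.
  by split=> //; move/eqP/eq_set2P => [[? ?]|[? ?]]; clash.
have nuv : u <> v by move=> uv; rewrite uv e_sym iv in Nui.
have [? ? ?] := edge_facts f_sym f_irr (f_eq neq_ic nvc iv).
have [? ? ?] := non_edge_facts f_sym nuv (Nf _ _ Nuv).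
have [? ? ?] := edge_facts f_sym f_irr fba.
have [? ? ?] := non_edge_facts f_sym nca Nfca.
exists [:: a; b; d; x; s; u; v; i]; split=> //; prove_trail.
Qed.

End Crossing.

(** * Repairing a realization *)

(** The pair of [a] and [b] contributes equally to both degrees; without it the neighbourhood of [a]
    is still the larger one. *)
Lemma private_nbr n (E : {set {set 'I_n}}) a b :
  simple_graph E -> a != b -> degree E b < degree E a ->
  exists w, [/\ adj E a w, ~~ adj E b w, w <> b & w <> a].
Proof.
move=> simE nab; rewrite !degreeE // (cardD1 b (adj E a)) (cardD1 a (adj E b)).
rewrite -!topredE /= (adj_sym E b a) ltn_add2l => lt_card.
have [/existsP[w /and4P[aw bw wb wa]]|none] :=
  boolP [exists w, [&& adj E a w, ~~ adj E b w, w != b & w != a]].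
  by exists w; split=> //; apply/eqP.
move: lt_card; rewrite ltnNge => /negP[]; apply: subset_leq_card.
apply/subsetP => w; rewrite !inE -!topredE /= => /andP[nwb aw].
have nwa : w != a by apply: contraTneq aw => ->; rewrite adj_irr.
rewrite nwa /=; apply: contraNT none => bw; apply/existsP; exists w.
by rewrite aw bw nwb nwa.
Qed.

Section Repair.

Variables (n : nat) (D : degvec n) (E : {set {set 'I_n}}) (r s : 'I_n).
Hypotheses (simE : simple_graph E) (nrs : r != s).
Hypothesis degE : forall v,
  Posz (degree E v) = (Posz (D v) + Posz (v == r) + Posz (v == s))%R.

Lemma near_flip x l : size l <= 11 ->
  (forall v, Posz (degree (flip E x l) v) = Posz (D v)) -> near D E.
Proof.
move=> size_l deg_l; apply: (nearI (x := x) size_l); apply/realizationsP; split.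
  exact: flip_simple.
by move=> v; case: (deg_l v).
Qed.

Lemma near_open l : trail (adj E) true r l -> odd (size l) -> last r l = s ->
  size l <= 11 -> near D E.
Proof.
move=> tr_l odd_l last_l size_l; apply: (near_flip (x := r) size_l) => v.
rewrite (degree_flip v tr_l) odd_l last_l degE /sgb /=.
by move: (D v) (v == r) (v == s) => d b1 b2; clear; lia.
Qed.

(** Now [s] has larger degree than [r], so an edge can be moved from [s] to [r] at the cost of two
    pairs. Only degrees are assumed, so that walks through a deleted edge qualify too. *)
Lemma near_closed_flip l : D r <= D s -> last r l = r -> size l <= 9 ->
  (forall v, Posz (degree (flip E r l) v) =
             (Posz (D v) + Posz (v == s) - Posz (v == r))%R) -> near D E.
Proof.
move=> leD last_l size_l degH; set H := flip E r l in degH.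
have simH : simple_graph H by apply: flip_simple.
have lt_deg : degree H r < degree H s.
  have := degH r; have := degH s; rewrite !eqxx (negbTE nrs) eq_sym (negbTE nrs).
  by move: leD (degree H r) (degree H s); move: (D r) (D s); clear; lia.
have nsr : s != r by rewrite eq_sym.
have [w [sw rw nwr nws]] := private_nbr simH nsr lt_deg.
have H_sym := @adj_sym n H.
have tr_w : trail (adj H) false r [:: w; s].
  have [? ? ?] := non_edge_facts H_sym (nesym nwr) rw.
  have [? ? ?] := edge_facts H_sym (adj_irr simH) sw.
  prove_trail.
apply: (near_flip (x := r) (l := l ++ [:: w; s])) => [|v].
  by rewrite size_cat addn2.
rewrite flip_cat last_l -/H (degree_flip v tr_w) degH /sgb /=.
by move: (D v) (v == r) (v == s) => d b1 b2; clear; lia.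
Qed.

Lemma near_closed l : D r <= D s -> trail (adj E) true r l -> odd (size l) ->
  last r l = r -> size l <= 9 -> near D E.
Proof.
move=> leD tr_l odd_l last_l size_l; apply: near_closed_flip size_l _ => // v.
rewrite (degree_flip v tr_l) odd_l last_l degE /sgb /=.
by move: (D v) (v == r) (v == s) => d b1 b2; clear; lia.
Qed.

Variable c : 'I_n.
Hypotheses (adj_rc : adj E r c) (Nadj_rs : ~~ adj E r s).

Let F := toggle E r c.

Lemma nbr_neq : r != c /\ s != c.
Proof.
split; first by apply: contraTneq adj_rc => <-; rewrite adj_irr.
by apply: contraTneq adj_rc => <-.
Qed.

Lemma toggled_simple : simple_graph F.
Proof. exact: toggle_simple. Qed.

Lemma toggled_degree v :
  Posz (degree F v) = (Posz (D v) + Posz (v == s) - Posz (v == c))%R.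
Proof.
have [nrc _] := nbr_neq; have := degree_toggle E v nrc; have := degE v.
rewrite adj_rc -/F; move: (degree F v) (degree E v) (D v).
by move: (v == r) (v == s) (v == c) => b1 b2 b3 d1 d2 d3; clear; lia.
Qed.

(** In [F] only [c] lacks an edge and only [s] has one too many; the trail corrects both. *)
Lemma near_from_nbr l : trail (adj F) false c l -> ~~ odd (size l) ->
  last c l = s -> size l <= 10 -> near D E.
Proof.
move=> tr_l even_l last_l size_l; apply: (near_flip (x := r) (l := c :: l)) => //.
move=> v; rewrite /= -/F (degree_flip v tr_l) (negbTE even_l) last_l.
rewrite toggled_degree /sgb /=.
by move: (D v) (v == s) (v == c) => d b1 b2; clear; lia.
Qed.

Lemma near_to_nbr l : trail (adj F) true s l -> ~~ odd (size l) ->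
  last s l = c -> size l <= 10 -> near D E.
Proof.
move=> tr_l even_l last_l size_l.
apply: (near_flip (x := s) (l := l ++ [:: r])) => [|v].
  by rewrite size_cat addn1.
rewrite flip_cat last_l /= -flip_toggle toggle_sym -/F.
rewrite (degree_flip v tr_l) (negbTE even_l) last_l toggled_degree /sgb /=.
by move: (D v) (v == s) (v == c) => d b1 b2; clear; lia.
Qed.

(* If the trail meets s, one of its two halves already leads from c to s;
   otherwise it leaves the edge between s and c' alone. *)
Lemma near_closed_nbr c' l : D c' <= D c -> adj E s c' -> c' != c ->
  trail (adj F) false c l -> odd (size l) -> last c l = c -> size l <= 7 ->
  near D E.
Proof.
move=> leD adj_sc' nc'c tr_l odd_l last_l size_l.
have [nrc nsc] := nbr_neq.
have [s_in_l|s_notin_l] := boolP (s \in l).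
  case/splitPr: s_in_l tr_l odd_l last_l size_l => l1 l2.
  rewrite -cat_rcons last_cat last_rcons size_cat size_rcons oddD /=.
  move=> tr_l odd_l last_l size_l.
  (* The total being odd, exactly one half has an even number of pairs. *)
  case odd1: (odd (size l1)) odd_l => /= odd_l.
    apply: near_from_nbr (trail_prefix tr_l) _ _ _.
    - by rewrite size_rcons /= odd1.
    - by rewrite last_rcons.
    - by rewrite size_rcons; apply: leq_trans (leq_trans (leq_addr _ _) size_l) _.
  have := trail_suffix tr_l; rewrite last_rcons size_rcons /= odd1 => tr_l2.
  apply: near_to_nbr tr_l2 _ _ _; rewrite ?odd_l //.
  exact: leq_trans (leq_trans (leq_addl _ _) size_l) _.
set H := flip F c l; have simF := toggled_simple.
have simH : simple_graph H by apply: flip_simple.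
have degH v : Posz (degree H v) = (Posz (D v) + Posz (v == s) + Posz (v == c))%R.
  rewrite (degree_flip v tr_l) odd_l last_l toggled_degree /sgb /=.
  by move: (D v) (v == s) (v == c) => d b1 b2; clear; lia.
have nc's : c' != s by apply: contraTneq adj_sc' => ->; rewrite adj_irr.
have H_sym := @adj_sym n H.
have adjH_sc' : adj H s c'.
  rewrite H_sym /H; rewrite adj_flip ?in_cons ?negb_or ?nsc //.
  rewrite /F adj_toggle // adj_sym adj_sc'.
  case: eq_set2P => // -[[_ sc]|[_ sr]]; first by rewrite sc eqxx in nsc.
  by case/negP: nrs; rewrite sr.
have lt_deg : degree H c' < degree H c.
  have := degH c; have := degH c'; rewrite !eqxx (negbTE nc'c) (negbTE nc's).
  rewrite eq_sym (negbTE nsc).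
  by move: leD (degree H c) (degree H c'); move: (D c) (D c'); clear; lia.
have ncc' : c != c' by rewrite eq_sym.
(* Both [c] and [s] have one edge too many in [H]; the trail c, w, c', s removes it. In all there
   are at most 1 + 7 + 3 = 11 pairs. *)
have [w [cw c'w nwc' nwc]] := private_nbr simH ncc' lt_deg.
have tr_w : trail (adj H) true c [:: w; c'; s].
  have [? ? ?] := edge_facts H_sym (adj_irr simH) cw.
  have [? ? ?] := non_edge_facts H_sym (nesym nwc') c'w.
  have [? ? ?] := edge_facts H_sym (adj_irr simH) adjH_sc'.
  have ? := elimN eqP ncc'; have ? := elimN eqP nsc.
  prove_trail.
apply: (near_flip (x := r) (l := c :: (l ++ [:: w; c'; s]))) => [|v].
  by rewrite /= size_cat addn3.
rewrite /= flip_cat last_l -/F -/H (degree_flip v tr_w) degH /sgb /=.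
by move: (D v) (v == s) (v == c) => d b1 b2; clear; lia.
Qed.

End Repair.

(** * Contradiction between the two cuts *)

Section Main.

Variables (n c1 c2 Sigma : nat).
Hypotheses (c2_gt0 : 0 < c2) (le_c21 : c2 <= c1) (c1_ltn : c1 < n).
Hypothesis Sigma_even : ~~ odd Sigma.
Hypothesis region_graphic : fully_graphic (region n Sigma c1 c2).
Variable D : degvec n.
Hypothesis D_region : D \in region n Sigma c1 c2.

Let bndD v := region_bounds D_region v.

Lemma near_of_le i j E : i != j -> D i <= D j ->
  E \in realizations (incr2 D i j) -> near D E.
Proof.
move=> nij leD /realizationsP[simE degE0].
have degE v : Posz (degree E v) = (Posz (D v) + Posz (v == i) + Posz (v == j))%R.
  by rewrite degE0 ffunE !PoszD.
apply: contraT => not_near.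
have e_sym := @adj_sym n E; have e_irr := adj_irr simE.
have nij' := elimN eqP nij.
have Neij : ~~ adj E i j.
  apply: contra not_near => eij; have [? ? ?] := edge_facts e_sym e_irr eij.
  apply: (near_open simE degE (l := [:: j])) => //; prove_trail.
have degE_card v : #|adj E v| = D v + (v == i) + (v == j).
  by rewrite -degreeE // degE0 ffunE.
have no_closed l : size l <= 7 -> odd (size l) -> last i l = i ->
    ~~ trail (adj E) true i l.
  move=> size_l odd_l last_l; apply: contra not_near => tr_l.
  apply: (near_closed simE nij degE leD tr_l) => //.
  exact: leq_trans size_l _.
have jN : j \notin upper (adj E) i.
  apply/negP => /(upperP e_sym)[eij|[_ _ [u u_thick uj]]].
    by rewrite eij in Neij.
  have [nui _ Nui [v [iv Nuv _]]] := thickP e_sym i u_thick.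
  have nuv : u <> v by move=> uv; rewrite uv e_sym iv in Nui.
  have [? ? ?] := edge_facts e_sym e_irr iv.
  have [? ? ?] := edge_facts e_sym e_irr uj.
  have [? ? ?] := non_edge_facts e_sym nuv Nuv.
  case/negP: not_near; apply: (near_open simE degE (l := [:: v; u; j])) => //.
  prove_trail.
have low_strict : c1 * (n - #|lower (adj E) i|) + c2 * #|lower (adj E) i| < Sigma.
  rewrite ltnNge; apply/negP => le_Sigma.
  have disj := upper_lower_disjoint i e_sym e_irr.
  have := low_cut c2_gt0 c1_ltn Sigma_even region_graphic D_region disj le_Sigma.
  have deg_i : c2 < #|adj E i|.
    rewrite degE_card eqxx; have /andP[] := bndD i.
    by move: (D i) (i == j); clear; lia.
  have deg_u u : u \in thick (adj E) i -> c2 <= #|adj E u|.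
    move=> _; rewrite degE_card; have /andP[] := bndD u.
    by move: (D u) (u == i) (u == j); clear; lia.
  have := sum_upper_degrees e_sym e_irr no_closed deg_i deg_u.
  (* The degrees in [E] agree with [D] on [upper], which contains neither [i] nor [j]. *)
  rewrite card_ord (eq_bigr D) => [|v vU].
    move: (\sum_(v in _) D v) (#|upper _ _|) (#|lower _ _|); clear.
    by move=> a b c; move: (b * n.-1) (c * c2) (b * c); clear; lia.
  rewrite degE_card; case: eqP => [vi|_].
    by have := root_notin_upper i e_sym e_irr; rewrite -{1}vi vU.
  by case: eqP => [vj|_]; rewrite ?addn0 //; rewrite vj (negbTE jN) in vU.
have [v0 v0P] : exists v0, adj E i v0 || adj E j v0.
  have /card_gt0P[v iv] : 0 < #|adj E i| by rewrite degE_card eqxx addn1.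
  by exists v; rewrite -[adj E i v]/(v \in adj E i) iv.
pose nbr := [pred v | adj E i v || adj E j v].
case: (@arg_maxnP _ v0 nbr D v0P) => c /= cP c_max.
have other_nbr (v : 'I_n) : (v == i) || (v == j) ->
    exists2 c', adj E v c' & c' != c.
  move=> vij; have /card_gt1P[x [y [vx vy nxy]]] : 1 < #|adj E v|.
    rewrite degE_card; have /andP[] := bndD v; move: vij c2_gt0.
    by move: (D v) (v == i) (v == j) c2 => d [] [] q; clear; lia.
  have [xc|nxc] := eqVneq x c; last by exists x.
  by exists y => //; rewrite -xc eq_sym.
(* [i] is preferred as [r], so that [c] and [i] are never adjacent once the edge [r c] is
   deleted. *)
have [r [s [r_case nrs degE' adj_rc c_s]]] : exists r s,
    [/\ r = i /\ s = j \/ [/\ r = j, s = i & ~~ adj E i c], r != s,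
       forall v, Posz (degree E v) = (Posz (D v) + Posz (v == r) + Posz (v == s))%R,
       adj E r c & (s == i) || (s == j)].
  have [eic|Neic] := boolP (adj E i c).
    by exists i, j; rewrite eqxx orbT; split=> //; left.
  exists j, i; rewrite eqxx eq_sym (negbTE Neic) in cP *; split=> //.
  - by right.
  - by move=> v; rewrite degE -!PoszD addnAC.
have [c' adj_sc' nc'c] := other_nbr s c_s.
have leDc : D c' <= D c.
  by apply: c_max; case/orP: c_s => /eqP <-; rewrite adj_sc' ?orbT.
have Nadj_rs : ~~ adj E r s.
  by case: r_case => [[-> ->]|[-> -> _]] //; rewrite e_sym.
have [nrc nsc] := nbr_neq simE adj_rc Nadj_rs.
pose F := toggle E r c; have simF : simple_graph F by apply: toggle_simple.
have f_sym := @adj_sym n F; have f_irr := adj_irr simF.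
have fE x y : adj F x y = adj E x y (+) ([set x; y] == [set r; c]).
  by rewrite adj_toggle.
have f_sub x y : adj F x y -> adj E x y.
  rewrite fE; case: eq_set2P => [[[-> ->]|[-> ->]]|_]; rewrite ?addbF //.
  by rewrite e_sym.
have f_eq x y : x <> c -> y <> c -> adj E x y -> adj F x y.
  by move=> nxc nyc exy; rewrite fE exy; case: eq_set2P => // [[[]|[]]].
have nic : i <> c by case: r_case => [[ri _]|[_ si _]] ic;
  [rewrite ri ic eqxx in nrc | rewrite si ic eqxx in nsc].
have Nfci : ~~ adj F c i.
  case: r_case => [[ri _]|[_ _ Neic]]; last first.
    by apply: contra Neic => /f_sub; rewrite e_sym.
  by rewrite fE e_sym -[X in adj E X c]ri adj_rc ri setUC eqxx.
(* If [r] is [i], then [c] is in [upper]. If [r] is [j], a trail from [i] to [c] ending with a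
   non-edge would extend to [j]. *)
have cNlower : c \notin lower (adj E) i.
  case: r_case => [[ri _]|[rj si Neic]].
    apply/negP => c_low; have := upper_lower_disjoint i e_sym e_irr.
    by move/disjointFl/(_ c_low); rewrite inE -[X in adj E X c]ri adj_rc.
  rewrite inE eq_sym (introF eqP nic) /=; apply/negP => /andP[cU].
  case/existsP => x /andP[xU Ncx].
  have ncx : c <> x by move=> cx; rewrite cx xU in cU.
  have [? ? ?] := non_edge_facts e_sym ncx Ncx.
  have [? ? ?] : [/\ j <> c, adj E j c = true & adj E c j = true].
    by apply: edge_facts => //; rewrite -rj.
  have [? ? ?] := non_edge_facts e_sym nij' Neij.
  have [? ? ?] := non_edge_facts e_sym nic Neic.
  have nxj : x <> j by move=> xj; rewrite -xj xU in jN.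
  case/(upperP e_sym): xU => [ix|[/negbT Nix nxi [u u_thick ux]]].
    have [? ? ?] := edge_facts e_sym e_irr ix.
    case/negP: not_near; apply: (near_open simE degE (l := [:: x; c; j])) => //.
    prove_trail.
  have [nui _ Nui [v [iv Nuv _]]] := thickP e_sym i u_thick.
  have nuv : u <> v by move=> uv; rewrite uv e_sym iv in Nui.
  have [? ? ?] := edge_facts e_sym e_irr iv.
  have [? ? ?] := edge_facts e_sym e_irr ux.
  have [? ? ?] := non_edge_facts e_sym nuv Nuv.
  have [? ? ?] := non_edge_facts e_sym nui (negbT Nui).
  have [? ? ?] := non_edge_facts e_sym (nesym nxi) Nix.
  case/negP: not_near.
  apply: (near_open simE degE (l := [:: v; u; x; c; j])) => //.
  prove_trail.
have cNthick : c \notin thick (adj E) i.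
  apply/negP => c_thick; have := thick_notin_upper e_sym e_irr no_closed c_thick.
  have [_ _ _ [v [iv Ncv _]]] := thickP e_sym i c_thick.
  have vU : v \in upper (adj E) i by rewrite inE iv.
  move=> cU; case/negP: cNlower; apply: non_neighbor_lower vU cU _ => //.
  by rewrite e_sym.
pose fC := compl_rel (adj F).
have fC_sym : symmetric fC := compl_rel_sym f_sym.
have fC_irr : irreflexive fC := @compl_rel_irr _ (adj F).
have no_closedC l : size l <= 7 -> odd (size l) -> last c l = c ->
    ~~ trail fC true c l.
  move=> size_l odd_l last_l; apply: contra not_near; rewrite trail_compl => tr_l.
  exact: (near_closed_nbr simE nrs degE' adj_rc Nadj_rs leDc adj_sc' nc'c tr_l).
(* The degree of [s] in [F] may exceed [c1], so [s] must be kept out of the degree bound for thick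
   vertices. *)
have sNthick : s \notin thick fC c.
  apply: contra not_near => s_thick.
  have [_ _ _ [a [ca Nsa _]]] := thickP fC_sym c s_thick.
  have /andP[/eqP nca Nfca] := ca.
  have nsa : s <> a.
    have [_ Ncs _ _] := thickP fC_sym c s_thick => sa.
    by rewrite -sa Ncs in ca.
  have fsa : adj F s a by move: Nsa; rewrite /fC /compl_rel (introN eqP nsa) negbK.
  have [? ? ?] := non_edge_facts f_sym nca Nfca.
  have [? ? ?] := edge_facts f_sym f_irr fsa.
  have ? := elimN eqP nsc.
  apply: (near_from_nbr simE degE' adj_rc Nadj_rs (l := [:: a; s])) => //.
  prove_trail.
have degF_card v : #|adj F v| + (v == c) = D v + (v == s).
  have := toggled_degree simE degE' adj_rc Nadj_rs v; rewrite -/F degreeE //.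
  by move: #|adj F v| (D v) (v == s) (v == c); clear; lia.
have cardC v : #|fC v| + #|adj F v| = n.-1.
  by rewrite card_compl_rel ?card_ord.
(* The same argument in the complement with [q = n.-1 - c1]; the deleted edge provides the surplus
   at the root [c]. *)
have high_strict : Sigma < c1 * #|lower fC c| + c2 * (n - #|lower fC c|).
  rewrite ltnNge; apply/negP => ge_Sigma.
  have disj := upper_lower_disjoint c fC_sym fC_irr.
  have disj' := disj; rewrite disjoint_sym in disj'.
  have := high_cut c2_gt0 c1_ltn Sigma_even region_graphic D_region disj' ge_Sigma.
  have deg_c : n.-1 - c1 < #|fC c|.
    have := cardC c; have := degF_card c; rewrite eqxx eq_sym (negbTE nsc).
    have /andP[_] := bndD c; move: c1_ltn.
    by move: #|fC c| #|adj F c| (D c); clear; lia.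
  have deg_u u : u \in thick fC c -> n.-1 - c1 <= #|fC u|.
    move=> u_thick; have [nuc _ _ _] := thickP fC_sym c u_thick.
    have nus : u != s by apply: contraNneq sNthick => <-.
    have := cardC u; have := degF_card u; rewrite (introF eqP nuc) (negbTE nus).
    have /andP[_] := bndD u; move: c1_ltn.
    by move: #|fC u| #|adj F u| (D u); clear; lia.
  have := sum_upper_degrees fC_sym fC_irr no_closedC deg_c deg_u.
  have le_sumD : \sum_(v in upper fC c) D v <= \sum_(v in upper fC c) #|adj F v|.
    apply: leq_sum => v vU; have := degF_card v.
    case: eqP vU => [->|_ _].
      by rewrite (negbTE (root_notin_upper c fC_sym fC_irr)).
    by rewrite addn0 => ->; apply: leq_addr.
  have sum_cardC : \sum_(v in upper fC c) #|fC v| +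
      \sum_(v in upper fC c) #|adj F v| = #|upper fC c| * n.-1.
    rewrite -big_split -sum_nat_const; apply: eq_bigr => v _; exact: cardC.
  move: le_sumD sum_cardC c1_ltn; rewrite card_ord.
  move: (\sum_(v in _) D v) (\sum_(v in _) #|fC v|) (\sum_(v in _) #|adj F v|).
  move: #|upper fC c| #|lower fC c|; clear => a b x y z le_xz eq_yz lt_c1 lt1 le2.
  (* This removes the truncated subtraction before [nia]. *)
  have eq_n : n.-1 = c1 + (n.-1 - c1) by move: lt_c1; clear; lia.
  move: lt1 le2 eq_yz; rewrite eq_n; move: (n.-1 - c1) le_xz => p; clear; nia.
have disjAB : [disjoint lower (adj E) i & lower fC c].
  rewrite disjoints_subset; apply/subsetP => x xA; rewrite inE.
  apply: contra not_near => xB.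
  have [l [tr_l last_l even_l size_l]] := crossing_trail e_sym f_sym f_irr f_sub
    f_eq nic Nfci cNlower cNthick xA xB.
  (* If [r] is [i], the deleted edge followed by the trail is a closed walk at [i] of at most 9
     pairs; otherwise the trail already leads from [c] to [s]. *)
  case: r_case => [[ri sj]|[rj si _]].
    apply: (near_closed_flip simE nij leD (l := c :: l)) => // v.
    rewrite /= -ri -/F (degree_flip v tr_l) (negbTE even_l) last_l.
    rewrite (toggled_degree simE degE' adj_rc Nadj_rs) ri sj /sgb /=.
    by move: (D v) (v == i) (v == j) (v == c) => d b1 b2 b3; clear; lia.
  apply: (near_from_nbr simE degE' adj_rc Nadj_rs tr_l) => //.
    by rewrite si.
  exact: leq_trans size_l _.
have le_n : #|lower (adj E) i| + #|lower fC c| <= n.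
  rewrite -cardsUI (_ : _ :&: _ = set0) ?cards0 ?addn0; last exact/disjoint_setI0.
  by rewrite -[X in _ <= X]card_ord max_card.
(* Together the cuts would make the product of [c1 - c2] and [n] minus both cardinals negative. *)
move: low_strict high_strict le_n le_c21; move: #|lower _ _| #|lower fC c|.
by clear; nia.
Qed.

Lemma near_all i j E : i != j -> E \in realizations (incr2 D i j) -> near D E.
Proof.
move=> nij ER; have [leD|ltD] := leqP (D i) (D j).
  exact: near_of_le nij leD ER.
apply: (@near_of_le j i); rewrite 1?eq_sym //; first exact: ltnW.
rewrite (_ : incr2 D j i = incr2 D i j) //.
by apply/ffunP => v; rewrite !ffunE addnAC.
Qed.

End Main.

Theorem theorem1p3 (n c1 c2 Sigma : nat)
    (hc2 : 0 < c2) (hc12 : c2 <= c1) (hn : c1 < n)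
    (hSpos : 0 < Sigma) (hSeven : ~~ odd Sigma)
    (hSup : Sigma <= n * c1) (hSlow : n * c2 <= Sigma)
    (hfull : fully_graphic (region n Sigma c1 c2)) :
  forall D : degvec n, D \in region n Sigma c1 c2 ->
    (partial_pp D <= 3 * n%:R ^+ 13)%R.
Proof.
move=> D D_region; apply: partial_pp_le.
- exact: leq_ltn_trans (leq0n c1) hn.
- exact: hfull.
move=> i j lt_ij E; apply: (near_all hc2 hc12 hn hSeven hfull D_region).
by rewrite -val_eqE neq_ltn lt_ij.
Qed.
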